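(* Let $0<p<1$ and let $f:\{0,1\}^n\to\{0,1\}$. Denote $\mathcal{W}(f)=p(1-p)\sum_{i=1}^nI_i(f)^2$. Then for every $\epsilon\in(0,1]$, \[ \mathcal{S}_\epsilon(f)\le(6e+1)\,\mathcal{W}(f)^{\alpha(\epsilon)\epsilon},\qquad\text{where }\alpha(\epsilon)=\frac{1}{\epsilon+\log(2B(p)e)+3\log\log(2B(p)e)} . \]
   Context: $\{0,1\}^n$ carries the product measure $\mu(x)=\prod_i p^{x_i}(1-p)^{1-x_i}$. For $x\in\{0,1\}^n$, $N_\epsilon(x)$ is the random vector obtained from $x$ by independently keeping each coordinate with probability $1-\epsilon$ and replacing it, with probability $\epsilon$, by a fresh random bit that equals $1$ with probability $p$. The noise stability is $\mathcal{S}_\epsilon(f)=\mathrm{Cov}_{x\sim\mu,\,y\sim N_\epsilon(x)}[f(x),f(y)]$. The influence is $I_i(f)=\Pr_{x\sim\mu}[f(x)\ne f(x\oplus e_i)]$, with $x\oplus e_i$ being $x$ with coordinate $i$ flipped. $B(p)=\frac{(1-p)-p}{2p(1-p)(\ln(1-p)-\ln p)}$ (with $B(1/2)=1$). $\log$ is the natural logarithm. *)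

(* Defs.v *)
From HB Require Import structures.
From mathcomp Require Import all_boot all_order all_algebra.
From mathcomp Require Import reals sequences exp.

Set Implicit Arguments.
Unset Strict Implicit.
Unset Printing Implicit Defensive.

Import Order.TTheory GRing.Theory Num.Theory.
Local Open Scope ring_scope.

Definition cube (n : nat) := {ffun 'I_n -> bool}.

(* A law on a finite type T is given by its mass function w : T -> R. *)
Definition Expect (R : realType) (T : finType) (w : T -> R) (X : T -> R) : R :=
  \sum_(t : T) w t * X t.

Definition Prob (R : realType) (T : finType) (w : T -> R) (A : pred T) : R :=
  \sum_(t : T | A t) w t.

Definition Cov (R : realType) (T : finType) (w : T -> R) (X Y : T -> R) : R :=
  Expect w (fun t => (X t - Expect w X) * (Y t - Expect w Y)).

Definition mu (R : realType) (n : nat) (p : R) (x : cube n) : R :=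
  \prod_(i < n) (p ^+ x i * (1 - p) ^+ (1 - x i)).

(* Coordinate i of x is replaced by the fresh bit z i exactly when r i. *)
Definition resample (n : nat) (x r z : cube n) : cube n :=
  [ffun i => if r i then z i else x i].

(* The law of N_eps(x): the replacement indicators are i.i.d. Bernoulli(eps),
   i.e. r ~ mu eps, and the fresh bits are z ~ mu p, independent of r. *)
Definition noise (R : realType) (n : nat) (p eps : R) (x y : cube n) : R :=
  Prob (fun rz : cube n * cube n => mu eps rz.1 * mu p rz.2)
       (fun rz => resample x rz.1 rz.2 == y).

Definition noise_pair (R : realType) (n : nat) (p eps : R)
    (xy : cube n * cube n) : R :=
  mu p xy.1 * noise p eps xy.1 xy.2.

Definition noise_stability (R : realType) (n : nat) (p eps : R)
    (f : cube n -> bool) : R :=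
  Cov (noise_pair p eps) (fun xy => (f xy.1)%:R) (fun xy => (f xy.2)%:R).

Definition flip (n : nat) (x : cube n) (i : 'I_n) : cube n :=
  [ffun j => x j (+) (j == i)].

Definition influence (R : realType) (n : nat) (p : R) (f : cube n -> bool)
    (i : 'I_n) : R :=
  Prob (@mu R n p) (fun x => f x != f (flip x i)).

Definition W (R : realType) (n : nat) (p : R) (f : cube n -> bool) : R :=
  p * (1 - p) * \sum_(i < n) influence p f i ^+ 2.

Definition B (R : realType) (p : R) : R :=
  if p == 1 / 2 then 1
  else ((1 - p) - p) / (2 * p * (1 - p) * (ln (1 - p) - ln p)).

Definition alpha (R : realType) (p eps : R) : R :=
  1 / (eps + ln (2 * B p * expR 1) + 3 * ln (ln (2 * B p * expR 1))).

(* Main.v *)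
(** Write [c] for the p-biased Fourier coefficients of [f] and
    [Stab rho = \sum_(S != set0) rho ^+ #|S| * c S ^+ 2], so that the noise
    stability is [Stab (1 - eps)].

    The part [g_i] of [f] that depends on coordinate [i] has [L^1]-norm
    [2 p (1 - p) I_i]. With [lam = min p (1 - p)] and [u = sqrt (lam / 6)], the
    two-point inequality gives a (2,4)-hypercontractive estimate for the noise
    operator [T_u], and two uses of Cauchy-Schwarz turn it into
    [<h, T_u h> <= |h|_1 |h|_2]. Applying this to [h_i = T_w g_i], where [w] is
    slightly below 1, and summing over [i] yields
    [Stab (u w ^+ 2) ^+ 2 <= W * \sum_S #|S| w ^+ (2 #|S|) c S ^+ 2 <= 100 W]: the
    preliminary noise [T_w] is what bounds the total influence. Jensen's
    inequality for [t |-> t `^ (2 alpha eps)] transfers the bound from the rate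
    [u w ^+ 2] to [1 - eps], because
    [- 2 ln (u w ^+ 2) <= ln (2 B e) + 3 ln (ln (2 B e))]. *)

Require Import Defs.
From mathcomp Require Import all_boot all_order all_algebra.
From mathcomp Require Import reals sequences exp.
From mathcomp Require Import ring lra.

Set Implicit Arguments.
Unset Strict Implicit.
Unset Printing Implicit Defensive.

Import Order.TTheory GRing.Theory Num.Theory.
Local Open Scope ring_scope.

(** * The p-biased Fourier basis and the noise kernel *)

Lemma indicator_eq_prod (R : realType) (n : nat) (x y : cube n) :
  (x == y)%:R = \prod_i (x i == y i)%:R :> R.
Proof.
have [->|xy] := eqVneq x y; first by rewrite big1// => i _; rewrite eqxx.
have [i xyi] : exists i, x i != y i.
  apply/existsP; apply: contraR xy; rewrite negb_exists => /forallP xy.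
  by apply/eqP/ffunP => i; move/negPn: (xy i) => /eqP.
by rewrite (bigD1 i)//= (negbTE xyi) mul0r.
Qed.

Section BiasedFourier.
Variables (R : realType) (n : nat) (p : R).
Hypotheses (p_gt0 : 0 < p) (p_lt1 : p < 1).

Definition mass (b : bool) : R := if b then p else 1 - p.

(** The standardized bit [(b - p) / sqrt (p (1 - p))], of mean 0 and variance 1 under [mass],
    written with a single square root whose square is [p (1 - p)]. *)
Definition phi (b : bool) : R :=
  if b then Num.sqrt (p * (1 - p)) / p else - (Num.sqrt (p * (1 - p)) / (1 - p)).

Definition chi (S : {set 'I_n}) (x : cube n) : R := \prod_(i in S) phi (x i).

(** The Markov kernel of the noise operator [T_rho], as a product over coordinates. *)
Definition kernel (rho : R) (x y : cube n) : R :=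
  \prod_i (rho * (x i == y i)%:R + (1 - rho) * mass (y i)).

Definition coef (f : cube n -> R) (S : {set 'I_n}) : R :=
  Expect (mu p) (fun x => f x * chi S x).

Definition fourier (c : {set 'I_n} -> R) (x : cube n) : R :=
  \sum_(S : {set 'I_n}) c S * chi S x.

Let q_gt0 : 0 < 1 - p. Proof. by rewrite subr_gt0. Qed.
Let p_neq0 : p != 0. Proof. by rewrite gt_eqF. Qed.
Let q_neq0 : 1 - p != 0. Proof. by rewrite gt_eqF. Qed.

Lemma sqr_sqrt_pq : Num.sqrt (p * (1 - p)) ^+ 2 = p * (1 - p).
Proof. by rewrite sqr_sqrtr// ltW// mulr_gt0. Qed.

Lemma mass_gt0 b : 0 < mass b. Proof. by case: b. Qed.

Lemma massE (b : bool) : p ^+ b * (1 - p) ^+ (1 - b) = mass b.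
Proof. by case: b; rewrite ?expr1 ?expr0 ?mulr1 ?mul1r. Qed.

Lemma muE (x : cube n) : mu p x = \prod_i mass (x i).
Proof. by apply: eq_bigr => i _; rewrite massE. Qed.

Lemma mu_gt0 (x : cube n) : 0 < mu p x.
Proof. by rewrite muE prodr_gt0// => i _; exact: mass_gt0. Qed.

Lemma mu_sum1 : \sum_(x : cube n) mu p x = 1.
Proof.
under eq_bigr do rewrite muE.
rewrite -(bigA_distr_bigA (fun _ b => mass b)); apply: big1 => i _.
by rewrite big_bool /mass /=; ring.
Qed.

(** Per coordinate, [rho [a = b] + (1 - rho) mass b = mass b (1 + rho phi a phi b)]. Expanding the
    product over coordinates gives the sum over [S], which diagonalizes the noise operator. *)
Lemma kernelE rho x y :
  kernel rho x y = mu p y * \sum_(S : {set 'I_n}) rho ^+ #|S| * chi S x * chi S y.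
Proof.
have -> : \sum_(S : {set 'I_n}) rho ^+ #|S| * chi S x * chi S y =
    \prod_i (rho * phi (x i) * phi (y i) + 1).
  rewrite bigA_distr; apply: eq_bigr => S _.
  rewrite -big_mkcond/= !big_split/= prodr_const.
  by rewrite /chi.
rewrite muE -big_split/=; apply: eq_bigr => i _.
have := sqr_sqrt_pq; rewrite /mass /phi; set r := Num.sqrt _ => r2.
case: (x i); case: (y i) => /=.
- rewrite (_ : rho * (r / p) * (r / p) = rho * r ^+ 2 / p ^+ 2); last by field.
  by rewrite r2; field.
- rewrite (_ : rho * (r / p) * _ = - (rho * r ^+ 2 / p / (1 - p))); last by field; rewrite p_neq0 q_neq0.
  by rewrite r2; field; rewrite p_neq0 q_neq0.
- rewrite (_ : rho * _ * _ = - (rho * r ^+ 2 / p / (1 - p))); last by field; rewrite p_neq0 q_neq0.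
  by rewrite r2; field; rewrite p_neq0 q_neq0.
- rewrite (_ : rho * _ * _ = rho * r ^+ 2 / (1 - p) ^+ 2); last by field.
  by rewrite r2; field.
Qed.

Lemma kernel_ge0 rho x y : 0 <= rho <= 1 -> 0 <= kernel rho x y.
Proof.
case/andP=> r0 r1; apply: prodr_ge0 => i _.
by rewrite addr_ge0// mulr_ge0 ?ler0n ?subr_ge0// ltW ?mass_gt0.
Qed.

Lemma kernel_sum1 rho x : \sum_y kernel rho x y = 1.
Proof.
rewrite /kernel -(bigA_distr_bigA (fun i b => rho * (x i == b)%:R + (1 - rho) * mass b)).
apply: big1 => i _; rewrite big_bool /mass; case: (x i) => /=; ring.
Qed.

(** Detailed balance: apart from the factor [mu p y], the expansion of [kernel] is symmetric in [x]
    and [y]. *)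
Lemma kernel_sym rho x y : mu p x * kernel rho x y = mu p y * kernel rho y x.
Proof.
rewrite !kernelE mulrCA; congr (_ * (_ * _)).
by apply: eq_bigr => S _; rewrite mulrAC.
Qed.

Lemma kernel_fourier rho f x :
  \sum_y kernel rho x y * f y = fourier (fun S : {set 'I_n} => rho ^+ #|S| * coef f S) x.
Proof.
rewrite /fourier /coef /Expect.
under eq_bigr do rewrite kernelE mulr_sumr mulr_suml.
rewrite exchange_big; apply: eq_bigr => S _ /=.
rewrite mulr_sumr mulr_suml; apply: eq_bigr => y _; ring.
Qed.

(** At [rho = 1] the kernel is the indicator of [x = y], so inversion is the case [T_1] of
    [kernel_fourier]. *)
Lemma fourier_inversion f x : fourier (coef f) x = f x.
Proof.
transitivity (fourier (fun S : {set 'I_n} => 1 ^+ #|S| * coef f S) x).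
  by apply: eq_bigr => S _; rewrite expr1n mul1r.
have kernel1 y : kernel 1 x y = (x == y)%:R.
  by rewrite indicator_eq_prod; apply: eq_bigr => i _; ring.
rewrite -kernel_fourier (bigD1 x)//= big1 ?addr0.
  by rewrite kernel1 eqxx mul1r.
by move=> y yx; rewrite kernel1 eq_sym (negbTE yx) mul0r.
Qed.

(** Under the product law the expectation factors; coordinate [i] contributes 0 exactly when it lies
    in one of the two sets only, and 1 otherwise. *)
Lemma chi_orthonormal S T :
  Expect (mu p) (fun x => chi S x * chi T x) = (S == T)%:R.
Proof.
pose F (i : 'I_n) b := mass b * ((if i \in S then phi b else 1) * (if i \in T then phi b else 1)).
have -> : Expect (mu p) (fun x => chi S x * chi T x) = \prod_i \sum_b F i b.
  rewrite bigA_distr_bigA; apply: eq_bigr => x _.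
  by rewrite muE /chi !(big_mkcond (fun i => i \in _))/= -!big_split.
have FE i : \sum_b F i b = ((i \in S) == (i \in T))%:R.
  rewrite big_bool /F /mass /phi; have := sqr_sqrt_pq; set r := Num.sqrt _ => r2.
  case: (i \in S); case: (i \in T) => /=.
  - rewrite (_ : _ + _ = r ^+ 2 / p / (1 - p)); last by field; rewrite p_neq0 q_neq0.
    by rewrite r2; field; rewrite p_neq0 q_neq0.
  - by field; rewrite p_neq0 q_neq0.
  - by field; rewrite p_neq0 q_neq0.
  - ring.
under eq_bigr do rewrite FE.
have [->|ST] := eqVneq S T; first by rewrite big1// => i _; rewrite eqxx.
have [i STi] : exists i, (i \in S) != (i \in T).
  apply/existsP; apply: contraR ST; rewrite negb_exists => /forallP xy.
  by apply/eqP/setP => i; move/negPn: (xy i) => /eqP.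
by rewrite (bigD1 i)//= (negbTE STi) mul0r.
Qed.

Lemma parseval c d :
  Expect (mu p) (fun x => fourier c x * fourier d x) = \sum_(S : {set 'I_n}) c S * d S.
Proof.
rewrite /Expect /fourier.
under eq_bigr do rewrite mulr_suml mulr_sumr.
rewrite exchange_big; apply: eq_bigr => S _ /=.
under eq_bigr do rewrite !mulr_sumr.
rewrite exchange_big/= (bigD1 S)//= [X in _ + X]big1 ?addr0.
  rewrite -[RHS]mulr1 -[X in _ = _ * X](_ : (S == S)%:R = 1); last by rewrite eqxx.
  rewrite -chi_orthonormal mulr_sumr; apply: eq_bigr => x _; ring.
move=> T TS; rewrite -[RHS](mulr0 (c S * d T)).
rewrite -[X in _ = _ * X](_ : (S == T)%:R = 0); last by rewrite eq_sym (negbTE TS).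
rewrite -chi_orthonormal mulr_sumr; apply: eq_bigr => x _; ring.
Qed.

Lemma coef_fourier c S : coef (fourier c) S = c S.
Proof.
rewrite /coef /Expect /fourier.
under eq_bigr do rewrite mulr_suml mulr_sumr.
rewrite exchange_big/= (bigD1 S)//= [X in _ + X]big1 ?addr0.
  rewrite -[RHS]mulr1 -[X in _ = _ * X](_ : (S == S)%:R = 1); last by rewrite eqxx.
  rewrite -chi_orthonormal mulr_sumr; apply: eq_bigr => x _; ring.
move=> T TS; rewrite -[RHS](mulr0 (c T)).
rewrite -[X in _ = _ * X](_ : (T == S)%:R = 0); last by rewrite (negbTE TS).
rewrite -chi_orthonormal mulr_sumr; apply: eq_bigr => x _; ring.
Qed.

(** The kernel is nonnegative, so the triangle inequality moves the absolute value inside the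
    average; by detailed balance the total weight then falling on [y] is [mu p y]. *)
Lemma noise_operator_L1_contraction rho c : 0 <= rho <= 1 ->
  Expect (mu p) (fun x => `|fourier (fun S : {set 'I_n} => rho ^+ #|S| * c S) x|) <=
  Expect (mu p) (fun x => `|fourier c x|).
Proof.
move=> rho01; rewrite /Expect.
apply: (@le_trans _ _ (\sum_x \sum_y mu p x * kernel rho x y * `|fourier c y|)).
  apply: ler_sum => x _.
  have -> : fourier (fun S : {set 'I_n} => rho ^+ #|S| * c S) x = \sum_y kernel rho x y * fourier c y.
    by rewrite kernel_fourier; apply: eq_bigr => S _; rewrite coef_fourier.
  under [X in _ <= X]eq_bigr do rewrite -mulrA.
  rewrite -mulr_sumr ler_pM2l ?mu_gt0//; apply: le_trans (ler_norm_sum _ _ _) _.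
  by apply: ler_sum => y _; rewrite normrM ger0_norm// kernel_ge0.
rewrite exchange_big/=; apply: ler_sum => y _.
under eq_bigr do rewrite kernel_sym.
by rewrite -mulr_suml -mulr_sumr kernel_sum1 mulr1.
Qed.

End BiasedFourier.

(** The bits [r i] and [z i] are independent over [i], so they can be summed out one coordinate at a
    time. *)
Lemma noiseE (R : realType) (n : nat) (p eps : R) (x y : cube n) :
  noise p eps x y = kernel p (1 - eps) x y.
Proof.
pose G (i : 'I_n) (r z : bool) : R :=
  mass eps r * mass p z * ((if r then z else x i) == y i)%:R.
have -> : noise p eps x y = \sum_(r : cube n) \sum_(z : cube n) \prod_i G i (r i) (z i).
  rewrite /noise /Prob pair_big/= big_mkcond/=; apply: eq_bigr => -[r z] _ /=.
  rewrite !big_split/= -!muE.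
  have -> : \prod_(i < n) ((if r i then z i else x i) == y i)%:R = (resample x r z == y)%:R :> R.
    by rewrite indicator_eq_prod; apply: eq_bigr => i _; rewrite ffunE.
  by case: ifP; rewrite ?mulr1 ?mulr0.
under eq_bigr do rewrite -(bigA_distr_bigA (fun i b => G i (_ i) b)).
rewrite -(bigA_distr_bigA (fun i a => \sum_b G i a b)).
apply: eq_bigr => i _; rewrite !big_bool /G /mass /=.
by case: (x i); case: (y i) => /=; ring.
Qed.

(** * Dependence on one coordinate, and influences *)

Section CoordinateAveraging.
Variables (R : realType) (n : nat) (p : R).
Hypotheses (p_gt0 : 0 < p) (p_lt1 : p < 1).
Implicit Types (x : cube n) (i : 'I_n) (S A : {set 'I_n}).

Lemma flipK i : involutive (fun x => flip x i).
Proof. by move=> x; apply/ffunP => j; rewrite !ffunE -addbA addbb addbF. Qed.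

Lemma flip_same x i : flip x i i = ~~ x i.
Proof. by rewrite ffunE eqxx addbT. Qed.

Lemma flip_other x i j : j != i -> flip x i j = x j.
Proof. by move=> ji; rewrite ffunE (negbTE ji) addbF. Qed.

Lemma mu_flip x i : mu p (flip x i) * mass p (x i) = mu p x * mass p (~~ x i).
Proof.
rewrite !muE (bigD1 i)//= [in RHS](bigD1 i)//= flip_same mulrAC [RHS]mulrAC.
rewrite [mass p (x i) * _]mulrC; congr (_ * _).
by apply: eq_bigr => j ji; rewrite flip_other.
Qed.

(** Averaging over bit [i] first. Once the second term is reindexed by [flip], [mu_flip] makes the
    two weights of [G x] add up to [mass p (x i) + mass p (~~ x i) = 1]. *)
Lemma Expect_coordinate i (G : cube n -> R) :
  Expect (mu p) G =
  Expect (mu p) (fun x => mass p (x i) * G x + mass p (~~ x i) * G (flip x i)).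
Proof.
rewrite /Expect; under [RHS]eq_bigr do rewrite mulrDr.
rewrite big_split/= [X in _ = _ + X](reindex_inj (inv_inj (flipK i)))/=.
rewrite -big_split/=; apply: eq_bigr => x _.
rewrite flipK flip_same negbK [X in _ = _ + X]mulrA mu_flip.
by rewrite /mass; case: (x i) => /=; ring.
Qed.

Lemma chi_flip_notin S i x : i \notin S -> chi p S (flip x i) = chi p S x.
Proof.
move=> iS; apply: eq_bigr => j jS; rewrite flip_other//.
by apply: contraNneq iS => <-.
Qed.

Lemma chi_setU1 S i x : i \notin S -> chi p (i |: S) x = phi p (x i) * chi p S x.
Proof. by move=> iS; rewrite /chi big_setU1. Qed.

Lemma sum_subset_setU1 (F : {set 'I_n} -> R) i A : i \notin A ->
  \sum_(S : {set 'I_n} | S \subset i |: A) F S =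
  \sum_(S : {set 'I_n} | S \subset A) F S + \sum_(S : {set 'I_n} | S \subset A) F (i |: S).
Proof.
move=> iA; rewrite (bigID (fun S : {set 'I_n} => i \in S))/= addrC; congr (_ + _).
  apply: eq_bigl => S; apply/andP/idP => [[SA iS]|SA].
    apply/subsetP => j jS; have := subsetP SA j jS.
    by rewrite in_setU1 => /predU1P[ji|//]; rewrite -ji jS in iS.
  split; first exact: subset_trans SA (subsetUr _ _).
  by apply: contra iA => /(subsetP SA).
rewrite (reindex_onto (fun S => i |: S) (fun S => S :\ i))/=; last first.
  by move=> S /andP[_ iS]; rewrite setD1K.
apply: eq_bigl => S; rewrite setU11 andbT; apply/andP/idP => [[SA /eqP SE]|SA].
  rewrite -SE; apply/subsetP => j; rewrite in_setD1 => /andP[ji jS].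
  by have := subsetP SA j jS; rewrite in_setU1 (negbTE ji).
split; first exact: setUS.
by rewrite setU1K// (contra _ iA)// => /(subsetP SA).
Qed.

(* The left-hand side is [f x - E_i f x], the part of [f] depending on coordinate [i]. *)
Lemma fourier_coordinate c x i :
  mass p (~~ x i) * (fourier p c x - fourier p c (flip x i)) =
  fourier p (fun S => (i \in S)%:R * c S) x.
Proof.
rewrite /fourier -sumrB mulr_sumr; apply: eq_bigr => S _.
have [iS|iS] := boolP (i \in S); last by rewrite chi_flip_notin//=; ring.
rewrite -(setD1K iS) !chi_setU1 ?setD11// chi_flip_notin ?setD11// flip_same.
have pN0 : p != 0 by rewrite gt_eqF.
have qN0 : 1 - p != 0 by rewrite gt_eqF// subr_gt0.
rewrite /mass /phi; case: (x i) => /=; field; by rewrite ?pN0 ?qN0.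
Qed.

Lemma influence_E (f : cube n -> bool) i :
  influence p f i = Expect (mu p) (fun x => (f x != f (flip x i))%:R).
Proof.
rewrite /influence /Prob big_mkcond; apply: eq_bigr => x _.
by case: ifP; rewrite ?mulr1 ?mulr0.
Qed.

(** As [f] is Boolean, [f x - f (flip x i)] has absolute value 0 or 1; averaging the weight
    [mass p (~~ x i)] over bit [i] produces [2 p (1 - p)]. *)
Lemma norm_coordinate_part (f : cube n -> bool) i :
  Expect (mu p) (fun x => `|fourier p (fun S : {set 'I_n} =>
     (i \in S)%:R * coef p (fun x => (f x)%:R) S) x|) =
  2 * p * (1 - p) * influence p f i.
Proof.
transitivity (Expect (mu p) (fun x => mass p (~~ x i) * (f x != f (flip x i))%:R)).
  apply: eq_bigr => x _; congr (_ * _).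
  rewrite -fourier_coordinate !fourier_inversion// normrM ger0_norm; last first.
    by rewrite ltW// mass_gt0.
  congr (_ * _); case: (f x); case: (f _) => /=;
    by rewrite ?subrr ?normr0 ?subr0 ?normr1 ?sub0r ?normrN ?normr1.
rewrite (Expect_coordinate i) influence_E /Expect mulr_sumr.
apply: eq_bigr => x _; rewrite flipK flip_same negbK (eq_sym (f (flip x i))).
rewrite /mass; case: (x i) => /=; ring.
Qed.

End CoordinateAveraging.

(** * The two-point inequality and (2,4)-hypercontractivity *)

Section Hypercontractivity.
Variable R : realType.

Lemma two_point_le_half (p u r a b : R) : 0 < p -> p <= 1 / 2 -> 0 <= u ->
  u ^+ 2 = p / 6 -> r ^+ 2 = p * (1 - p) -> 0 < r ->
  p * (a + u * (r / p) * b) ^+ 4 + (1 - p) * (a - u * (r / (1 - p)) * b) ^+ 4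
    <= (a ^+ 2 + u * b ^+ 2) ^+ 2.
Proof.
move=> p0 p1 u0 u2 r2 r0.
have pN0 : p != 0 by rewrite gt_eqF.
have q0 : 0 < 1 - p by lra.
have qN0 : 1 - p != 0 by rewrite gt_eqF.
have rN0 : r != 0 by rewrite gt_eqF.
have r4 : r ^+ 4 = (p * (1 - p)) ^+ 2 by rewrite -r2; ring.
(* With [phi] the standardized bit, [k = u E[phi^3]] and [m = u^2 E[phi^4]]. *)
pose k := u * (1 - 2 * p) / r.
pose m := (1 - 3 * p * (1 - p)) / (6 * (1 - p)).
have -> : p * (a + u * (r / p) * b) ^+ 4 + (1 - p) * (a - u * (r / (1 - p)) * b) ^+ 4 =
   a ^+ 4 + 6 * u ^+ 2 * a ^+ 2 * b ^+ 2 + 4 * u ^+ 2 * k * a * b ^+ 3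
   + u ^+ 2 * m * b ^+ 4.
  transitivity (a ^+ 4 + 6 * u ^+ 2 * a ^+ 2 * b ^+ 2 * (r ^+ 2 / (p * (1 - p)))
     + 4 * u ^+ 2 * a * b ^+ 3 * (u * (1 - 2 * p) / r * (r ^+ 4 / (p * (1 - p)) ^+ 2))
     + u ^+ 2 * b ^+ 4 * (u ^+ 2 * (1 - 3 * p * (1 - p)) * (r ^+ 4 / (p * (1 - p)) ^+ 3))).
    by field; rewrite ?pN0 ?qN0 ?rN0.
  rewrite r2 r4 [in X in _ + u ^+ 2 * _ * X]u2 /k /m.
  by field; rewrite ?pN0 ?qN0 ?rN0.
have k2 : k ^+ 2 <= 1 / 6.
  have -> : k ^+ 2 = (1 - 2 * p) ^+ 2 / (6 * (1 - p)).
    transitivity (u ^+ 2 * (1 - 2 * p) ^+ 2 / r ^+ 2); first by rewrite /k; field.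
    by rewrite u2 r2; field; rewrite ?pN0 ?qN0.
  rewrite ler_pdivrMr; last by lra.
  have : 0 <= p * (1 / 2 - p) by apply: mulr_ge0; lra.
  lra.
have m4 : m <= 1 / 6.
  rewrite /m ler_pdivrMr; last by lra.
  have : 0 <= p * (1 / 2 - p) by apply: mulr_ge0; lra.
  lra.
(* Given [ab] and [m <= 1/6], the [b^4] terms balance exactly, and the [a^2 b^2] terms require
   [6 u^2 + 4/5 u^2 <= 2 u]. This is [u <= 5/17], which follows from [u^2 = p / 6 <= 1/12]. *)
have u1 : 34 * u ^+ 2 <= 10 * u.
  rewrite expr2 mulrA ler_wpM2r//.
  have : u ^+ 2 <= (5 / 17) ^+ 2 by lra.
  rewrite ler_sqr ?nnegrE//; lra.
(* AM-GM: [4 k a b <= 24/5 (k a)^2 + 5/6 b^2] *)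
have ab : 4 * k * a * b <= 4 / 5 * a ^+ 2 + 5 / 6 * b ^+ 2.
  have : 0 <= 24 / 5 * (1 / 6 - k ^+ 2) * a ^+ 2 by rewrite mulr_ge0 ?sqr_ge0//; lra.
  have : 0 <= (12 * k * a - 5 * b) ^+ 2 by exact: sqr_ge0.
  lra.
have : 0 <= u ^+ 2 * b ^+ 2 * (4 / 5 * a ^+ 2 + 5 / 6 * b ^+ 2 - 4 * k * a * b).
  by apply: mulr_ge0; [rewrite mulr_ge0 ?sqr_ge0 | lra].
have : 0 <= u ^+ 2 * (1 / 6 - m) * b ^+ 4.
  rewrite mulr_ge0 ?exprn_even_ge0// mulr_ge0 ?sqr_ge0//; lra.
have : 0 <= (10 * u - 34 * u ^+ 2) * (a * b) ^+ 2 by rewrite mulr_ge0 ?sqr_ge0//; lra.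
lra.
Qed.

Variables (n : nat) (p : R).
Hypotheses (p_gt0 : 0 < p) (p_lt1 : p < 1).

(* The constant 6 leaves room in both the two-point inequality and
   [stability_L_bounds]. *)
Definition hyper_rate : R := Num.sqrt (Num.min p (1 - p) / 6).
Local Notation u := hyper_rate.

Lemma min_pq_gt0 : 0 < Num.min p (1 - p).
Proof. by rewrite lt_min p_gt0 subr_gt0. Qed.

Lemma hyper_rate_gt0 : 0 < u.
Proof. by rewrite sqrtr_gt0 divr_gt0// min_pq_gt0. Qed.

Lemma sqr_hyper_rate : u ^+ 2 = Num.min p (1 - p) / 6.
Proof. by rewrite sqr_sqrtr// divr_ge0// ltW// min_pq_gt0. Qed.

Lemma two_point_le (c : bool) a b :
  mass p c * (a + u * phi p c * b) ^+ 4 + mass p (~~ c) * (a + u * phi p (~~ c) * b) ^+ 4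
    <= (a ^+ 2 + u * b ^+ 2) ^+ 2.
Proof.
have r2 := sqr_sqrt_pq p_gt0 p_lt1; have u2 := sqr_hyper_rate.
have r0 : 0 < Num.sqrt (p * (1 - p)) by rewrite sqrtr_gt0 mulr_gt0// subr_gt0.
wlog -> : c / c = true.
  by case: c => /(_ true erefl)//=; rewrite addrC.
rewrite /mass /phi /=; set r := Num.sqrt _ in r2 r0 *.
have u0 := ltW hyper_rate_gt0.
have [p2|p2] := leP p (1 - p).
  rewrite mulrN mulNr; apply: two_point_le_half => //; first by lra.
  by rewrite u2 min_l.
(* Exchanging the two values of the bit replaces [p] by [1 - p] and [b] by [- b]. *)
have qp : 1 - (1 - p) = p by ring.
have := @two_point_le_half (1 - p) u r a (- b); rewrite qp sqrrN => le4.
have q0 : 0 < 1 - p by rewrite subr_gt0.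
have q2 : 1 - p <= 1 / 2 by lra.
have u2' : u ^+ 2 = (1 - p) / 6 by rewrite u2 min_r// ltW.
have r2' : r ^+ 2 = (1 - p) * p by rewrite r2 mulrC.
apply: le_trans (le4 q0 q2 u0 u2' r2' r0); rewrite le_eqVlt; apply/orP; left.
by apply/eqP; ring.
Qed.

Lemma Expect_le (T : finType) (w : T -> R) (X Y : T -> R) :
  (forall t, 0 <= w t) -> (forall t, X t <= Y t) -> Expect w X <= Expect w Y.
Proof. by move=> w0 XY; apply: ler_sum => t _; rewrite ler_wpM2l. Qed.

(** The quadratic [E (a - s b)^2] in [s] is nonnegative, in particular at its minimizer
    [s = X / B]. *)
Lemma Cauchy_Schwarz_sum (T : finType) (w a b : T -> R) : (forall t, 0 <= w t) ->
  Expect w (fun t => a t * b t) ^+ 2 <=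
  Expect w (fun t => a t ^+ 2) * Expect w (fun t => b t ^+ 2).
Proof.
move=> w0; set X := Expect w (fun t => a t * b t).
set A := Expect w (fun t => a t ^+ 2); set B := Expect w (fun t => b t ^+ 2).
have B0 : 0 <= B by apply: sumr_ge0 => t _; rewrite mulr_ge0// sqr_ge0.
have quad s : 0 <= A - 2 * s * X + s ^+ 2 * B.
  have -> : A - 2 * s * X + s ^+ 2 * B = Expect w (fun t => (a t - s * b t) ^+ 2).
    rewrite /A /X /B /Expect !mulr_sumr -sumrB -big_split/=.
    by apply: eq_bigr => t _; ring.
  by apply: sumr_ge0 => t _; rewrite mulr_ge0// sqr_ge0.
have [B00|BN0] := eqVneq B 0.
  suff -> : X = 0 by rewrite expr0n/= B00 mulr0.
  (* For [B = 0] the quadratic is affine in [s]; this choice of [s] would give it the value -1. *)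
  apply/eqP; apply: contraT => XN0; have := quad ((A + 1) / (2 * X)).
  rewrite B00 mulr0 addr0 (_ : 2 * _ * X = A + 1); first lra.
  by field.
have Bp : 0 < B by rewrite lt_def BN0.
have := quad (X / B); rewrite -(pmulr_lge0 _ Bp).
rewrite (_ : (A - 2 * (X / B) * X + (X / B) ^+ 2 * B) * B = A * B - X ^+ 2) ?subr_ge0//.
by field.
Qed.

(** Induction on the size of [A], with the cube fixed. For [A = i |: A'] the function is
    [a + u phi (x i) b], where [a] and [b] do not depend on bit [i]. The two-point inequality
    averages its fourth power over that bit to at most [(a^2 + u b^2)^2]; the induction hypothesis
    bounds [E a^4] and [E b^4], and Cauchy-Schwarz the mixed term. *)
Lemma hypercontractivity_subset (A : {set 'I_n}) (c : {set 'I_n} -> R) :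
  Expect (mu p) (fun x => (\sum_(S : {set 'I_n} | S \subset A) u ^+ #|S| * c S * chi p S x) ^+ 4)
  <= (\sum_(S : {set 'I_n} | S \subset A) u ^+ #|S| * c S ^+ 2) ^+ 2.
Proof.
have u0 := ltW hyper_rate_gt0.
have mu0 (x : cube n) : 0 <= mu p x by rewrite ltW// mu_gt0.
move: {2}#|A| (erefl #|A|) => k; elim: k A c => [|k IH] A c Ak.
  move/eqP: Ak; rewrite cards_eq0 => /eqP ->.
  have sub0 (S : {set 'I_n}) : (S \subset (set0 : {set 'I_n})) = (S == set0) by rewrite subset0.
  under [X in _ <= X ^+ 2]eq_bigl do rewrite sub0.
  rewrite big_pred1_eq cards0 expr0 mul1r /Expect.
  under eq_bigr => x _.
    under eq_bigl do rewrite sub0.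
    rewrite big_pred1_eq cards0 expr0 mul1r /chi big_set0 mulr1.
    over.
  by rewrite -mulr_suml mu_sum1 mul1r -exprM.
have [i iA] : exists i, i \in A by apply/set0Pn; rewrite -cards_eq0 Ak.
have [A' [iA' AE A'k]] : exists A' : {set 'I_n}, [/\ i \notin A', A = i |: A' & #|A'| = k].
  exists (A :\ i); rewrite setD11 setD1K//; split=> //.
  by have := cardsD1 i A; rewrite iA Ak add1n => -[].
rewrite {A iA Ak}AE.
pose a x := \sum_(S : {set 'I_n} | S \subset A') u ^+ #|S| * c S * chi p S x.
pose b x := \sum_(S : {set 'I_n} | S \subset A') u ^+ #|S| * c (i |: S) * chi p S x.
have notinS (S : {set 'I_n}) : S \subset A' -> i \notin S by move=> SA; apply: contra iA' => /(subsetP SA).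
have FE x : \sum_(S : {set 'I_n} | S \subset i |: A') u ^+ #|S| * c S * chi p S x =
    a x + u * phi p (x i) * b x.
  rewrite sum_subset_setU1//; congr (_ + _); rewrite mulr_sumr.
  apply: eq_bigr => S SA; rewrite cardsU1 notinS// chi_setU1 ?notinS// exprD expr1.
  ring.
have aflip x : a (flip x i) = a x.
  by apply: eq_bigr => S SA; rewrite chi_flip_notin ?notinS.
have bflip x : b (flip x i) = b x.
  by apply: eq_bigr => S SA; rewrite chi_flip_notin ?notinS.
rewrite sum_subset_setU1//.
set SA := \sum_(S : {set 'I_n} | S \subset A') u ^+ #|S| * c S ^+ 2.
pose SB := \sum_(S : {set 'I_n} | S \subset A') u ^+ #|S| * c (i |: S) ^+ 2.
have -> : \sum_(S : {set 'I_n} | S \subset A') u ^+ #|i |: S| * c (i |: S) ^+ 2 = u * SB.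
  rewrite mulr_sumr; apply: eq_bigr => S SAS.
  by rewrite cardsU1 notinS// exprD expr1 mulrA.
have SA0 : 0 <= SA by apply: sumr_ge0 => S _; rewrite mulr_ge0 ?sqr_ge0 ?exprn_ge0.
have SB0 : 0 <= SB by apply: sumr_ge0 => S _; rewrite mulr_ge0 ?sqr_ge0 ?exprn_ge0.
have a4 : Expect (mu p) (fun x => a x ^+ 4) <= SA ^+ 2 by exact: IH.
have b4 : Expect (mu p) (fun x => b x ^+ 4) <= SB ^+ 2.
  exact: (IH A' (fun S => c (i |: S))).
have a2b2 : Expect (mu p) (fun x => a x ^+ 2 * b x ^+ 2) <= SA * SB.
  rewrite -ler_sqr ?nnegrE ?mulr_ge0//; last first.
    by apply: sumr_ge0 => x _; rewrite mulr_ge0// mulr_ge0 ?sqr_ge0.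
  have E4 (g : cube n -> R) :
      Expect (mu p) (fun x => (g x ^+ 2) ^+ 2) = Expect (mu p) (fun x => g x ^+ 4).
    by apply: eq_bigr => x _; rewrite -exprM.
  apply: le_trans (Cauchy_Schwarz_sum _ _ mu0) _; rewrite !E4 exprMn.
  apply: ler_pM a4 b4; apply: sumr_ge0 => x _; by rewrite mulr_ge0// exprn_even_ge0.
apply: (@le_trans _ _ (Expect (mu p) (fun x => (a x ^+ 2 + u * b x ^+ 2) ^+ 2))).
  rewrite (Expect_coordinate p i); apply: Expect_le => // x.
  by rewrite !FE aflip bflip flip_same; exact: two_point_le.
have -> : Expect (mu p) (fun x => (a x ^+ 2 + u * b x ^+ 2) ^+ 2) =
   Expect (mu p) (fun x => a x ^+ 4) + 2 * u * Expect (mu p) (fun x => a x ^+ 2 * b x ^+ 2)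
   + u ^+ 2 * Expect (mu p) (fun x => b x ^+ 4).
  by rewrite /Expect !mulr_sumr -!big_split/=; apply: eq_bigr => x _; ring.
rewrite (_ : (SA + u * SB) ^+ 2 = SA ^+ 2 + 2 * u * (SA * SB) + u ^+ 2 * SB ^+ 2); last by ring.
by rewrite !lerD// ler_wpM2l// ?mulr_ge0 ?sqr_ge0.
Qed.

Lemma hypercontractivity (c : {set 'I_n} -> R) :
  Expect (mu p) (fun x => fourier p (fun S : {set 'I_n} => u ^+ #|S| * c S) x ^+ 4)
  <= (\sum_(S : {set 'I_n}) u ^+ #|S| * c S ^+ 2) ^+ 2.
Proof.
have := hypercontractivity_subset setT c.
under [X in _ <= X ^+ 2 -> _]eq_bigl do rewrite subsetT.
congr (_ <= _); apply: eq_bigr => x _; congr (_ * _ ^+ 4).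
by apply: eq_bigl => S; rewrite subsetT.
Qed.

End Hypercontractivity.

(** * Exponential inequalities and lower bounds on [B] *)

Section RealInequalities.
Variable R : realType.

Lemma expR_ge_quadratic (x : R) : 0 <= x -> 1 + x + x ^+ 2 / 2 <= expR x.
Proof.
move=> x0; have [->|xN0] := eqVneq x 0; first by rewrite expR0; lra.
rewrite /expR.
have -> : 1 + x + x ^+ 2 / 2 = series (exp_coeff x) 3.
  by rewrite /series/= !big_nat_recr//= big_nil /exp_coeff/= !factS fact0; field.
apply: nondecreasing_cvgn_le; last exact: is_cvg_series_exp_coeff.
by apply/nondecreasing_series => k _ _; exact: exp_coeff_ge0.
Qed.

Lemma sinh_ge (x : R) : 0 <= x -> 2 * x <= expR x - expR (- x).
Proof.
move=> x0; have := expR_ge_quadratic x0; set g := 1 + x + x ^+ 2 / 2 => gE.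
have x2 : 0 <= x ^+ 2 by exact: sqr_ge0.
have g0 : 0 < g by rewrite /g; lra.
have : expR (- x) <= g^-1 by rewrite expRN lef_pV2 ?posrE// expR_gt0.
(* After multiplication by [g] the gap is exactly [x^4 / 4]. *)
have : 2 * x <= g - g^-1.
  rewrite -(ler_pM2r g0) mulrBl mulVf ?gt_eqF//.
  have : 0 <= x ^+ 4 by rewrite exprn_even_ge0.
  rewrite /g; lra.
lra.
Qed.

(** The tangent bound [1 + x <= expR x] at [1/8] and [-1/8], raised to the eighth power. *)
Lemma expR1_bounds : 64 / 25 <= expR 1 :> R /\ expR 1 <= 3 :> R.
Proof.
have e8 : expR 1 = expR (1 / 8) ^+ 8 :> R.
  by rewrite -expRM_natl; congr expR; field.
split.
  have h : 9 / 8 <= expR (1 / 8) :> R by apply: le_trans (expR_ge1Dx _); lra.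
  rewrite e8; apply: (@le_trans _ _ ((9 / 8) ^+ 8)); first by lra.
  by rewrite lerXn2r ?nnegrE ?expR_ge0//; lra.
have h : expR (1 / 8) <= 8 / 7 :> R.
  have : 7 / 8 <= expR (- (1 / 8)) :> R by apply: le_trans (expR_ge1Dx _); lra.
  rewrite expRN => h; rewrite -(invrK (expR _)) -[8 / 7]invrK lef_pV2 ?posrE ?invr_gt0 ?expR_gt0//; lra.
rewrite e8; apply: (@le_trans _ _ ((8 / 7) ^+ 8)); last by lra.
by rewrite lerXn2r ?nnegrE ?expR_ge0//; lra.
Qed.

Lemma cosh_ge (z : R) : expR (1 / 2 + z / 4) <= expR (z / 2) + expR (- (z / 2)).
Proof.
set w := expR (z / 4); have w0 : 0 < w by exact: expR_gt0.
have c0 : 0 < expR (1 / 2) :> R by exact: expR_gt0.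
have c1 : expR (1 / 2) <= 7 / 4 :> R.
  rewrite -ler_sqr ?nnegrE ?(ltW c0)//; last by lra.
  rewrite -expRM_natl (_ : 2%:R * (1 / 2) = 1); last by field.
  have [_ ?] := expR1_bounds; lra.
rewrite expRD expRN (_ : expR (z / 2) = w ^+ 2); last first.
  by rewrite -expRM_natl; congr expR; field.
rewrite -/w; apply: (@le_trans _ _ (7 / 4 * w)); first by rewrite ler_pM2r.
have w2 : 0 < w ^+ 2 by rewrite exprn_gt0.
rewrite -(ler_pM2r w2) [leRHS]mulrDl mulVf ?gt_eqF//.
(* What remains is [7/4 w^3 <= w^4 + 1], whose smallest margin is about 1/100, at [w = 21/16]; the
   squares are hints for [nra]. *)
have : 0 <= (w ^+ 2 - 7 / 8 * w - 1 / 2) ^+ 2 by exact: sqr_ge0.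
have : 0 <= (w - 5 / 4) ^+ 2 by exact: sqr_ge0.
nra.
Qed.

Lemma B_sym (p : R) : B (1 - p) = B p.
Proof.
rewrite /B subKr; have [p2|p2] := eqVneq p (1 / 2).
  by rewrite ifT//; apply/eqP; lra.
rewrite ifF; last by apply/eqP => h; move/eqP: p2; apply; lra.
rewrite (_ : p - (1 - p) = - (1 - p - p)); last by ring.
rewrite (_ : ln p - ln (1 - p) = - (ln (1 - p) - ln p)); last by ring.
rewrite mulrN invrN mulrNN; congr (_ / (_ * _)); ring.
Qed.

(* Here [z = ln ((1 - p) / p)], for which [B p = sinh z / z]. *)
Lemma B_bounds_lt_half (p : R) : 0 < p -> p < 1 / 2 ->
  exists2 z : R, 0 <= z &
  [/\ 0 < B p, 1 <= 2 * B p * p * (1 + z) & expR (1 / 2 + z / 4) <= 2 * B p].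
Proof.
move=> p0 p2; have q0 : 0 < 1 - p by lra.
pose z := ln (1 - p) - ln p; have z0 : 0 < z by rewrite subr_gt0 ltr_ln ?posrE; lra.
have pE : 1 - p = p * expR z by rewrite expRB !lnK ?posrE//; field; rewrite gt_eqF.
have zN0 : z != 0 by rewrite gt_eqF.
have pN0 : p != 0 by rewrite gt_eqF.
have qN0 : 1 - p != 0 by rewrite gt_eqF.
have BE : B p = (1 - 2 * p) / (2 * p * (1 - p) * z).
  rewrite /B ifF -/z; last by apply/eqP; lra.
  by congr (_ / _); ring.
have e0 := expR_gt0 z; have eN0 : expR z != 0 by rewrite gt_eqF.
have pe : p * (1 + expR z) = 1 by rewrite mulrDr mulr1 -pE; ring.
have e1N0 : 1 + expR z != 0 by rewrite gt_eqF//; lra.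
have pE' : p = (1 + expR z)^-1 by apply: (mulIf e1N0); rewrite mulVf.
have B2E : 2 * B p = (expR z - expR (- z)) / z.
  rewrite BE expRN pE'; field; by rewrite zN0 eN0 e1N0.
have Bp : 2 * B p * p = (1 - expR (- z)) / z.
  rewrite B2E expRN [in LHS]pE'; field; by rewrite zN0 eN0 e1N0.
exists z; first exact: ltW.
split.
- rewrite -(pmulr_rgt0 _ (ltr0n _ 2 : 0 < 2%:R :> R)) B2E divr_gt0// subr_gt0 ltr_expR; lra.
(* This is [(1 - e^(-z)) / z >= 1 / (1 + z)], from [1 + z <= e^z]. *)
- rewrite Bp mulrAC ler_pdivlMr// mul1r expRN mulrBl mul1r.
  have : (expR z)^-1 * (1 + z) <= 1 by rewrite mulrC ler_pdivrMr// mul1r expR_ge1Dx.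
  lra.
(* By the double-angle formula and [sinh (z / 2) >= z / 2], one has
   [2 B p = 2 sinh z / z >= 2 cosh (z / 2)]. *)
- apply: le_trans (cosh_ge z) _; rewrite B2E ler_pdivlMr//.
  have -> : expR z - expR (- z) =
     (expR (z / 2) + expR (- (z / 2))) * (expR (z / 2) - expR (- (z / 2))).
    rewrite [RHS]mulrC -subr_sqr -!expRM_natl; by congr (expR _ - expR _); field.
  rewrite ler_pM2l ?addr_gt0 ?expR_gt0//.
  have z2 : 0 <= z / 2 by lra.
  have := sinh_ge z2; lra.
Qed.

(** The two bounds share one [z]: the first loses a factor [1 + z], which the cube of
    [stability_L p] recovers, since by the second bound [stability_L p] grows at least linearly in
    [z]. *)
Lemma B_bounds (p : R) : 0 < p -> p < 1 ->
  exists2 z : R, 0 <= z &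
  [/\ 0 < B p, 1 <= 2 * B p * Num.min p (1 - p) * (1 + z)
    & expR (1 / 2 + z / 4) <= 2 * B p].
Proof.
move=> p0 p1; have [p2|p2|p2] := ltgtP p (1 / 2).
- have [z z0 zP] := B_bounds_lt_half p0 p2.
  by exists z => //; rewrite min_l//; lra.
- have q0 : 0 < 1 - p by lra.
  have q2 : 1 - p < 1 / 2 by lra.
  have [z z0 zP] := B_bounds_lt_half q0 q2; rewrite B_sym in zP.
  by exists z => //; rewrite min_r//; lra.
- exists 0 => //; rewrite p2 /B eqxx minEle ifT; last by lra.
  rewrite mul0r !addr0; split; [lra|lra|].
  have := @cosh_ge 0; rewrite mul0r !addr0 mul0r oppr0 expR0; lra.
Qed.

(** The denominator of [alpha p eps] is [eps + stability_L p + 3 * ln (stability_L p)]. *)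
Definition stability_L (p : R) : R := ln (2 * B p * expR 1).

(** The second bound is the exponential form of [- 2 ln (base_rate p) <= L + 3 ln L] for
    [L = stability_L p]. *)
Lemma stability_L_bounds (p : R) : 0 < p -> p < 1 ->
  3 / 2 <= stability_L p /\
  (1 + 1 / 200) ^+ 4 <=
    Num.min p (1 - p) / 6 * (2 * B p * expR 1) * stability_L p ^+ 3.
Proof.
move=> p0 p1; have [z z0 [B0 Bz Be]] := B_bounds p0 p1.
have [e1 _] := expR1_bounds.
have Lz : 3 / 2 + z / 4 <= stability_L p.
  rewrite /stability_L -[leLHS]expRK ler_ln ?posrE ?expR_gt0//; last first.
    by rewrite !mulr_gt0 ?expR_gt0.
  rewrite (_ : 3 / 2 + z / 4 = 1 / 2 + z / 4 + 1); last by field.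
  by rewrite expRD ler_pM2r ?expR_gt0.
split; first by lra.
have z10 : 0 < 1 + z by lra.
have L3 : 12 / 5 * (1 + z) <= stability_L p ^+ 3.
  apply: (@le_trans _ _ ((3 / 2 + z / 4) ^+ 3)).
    have : 0 <= z ^+ 3 by rewrite exprn_ge0.
    (* The number [19/15] is the centre of the quadratic part of the difference of the two sides. *)
    have : 0 <= (z - 19 / 15) ^+ 2 by exact: sqr_ge0.
    lra.
  by rewrite lerXn2r ?nnegrE//; lra.
set l := Num.min p (1 - p) in Bz *.
have l0 : 0 < l by rewrite lt_min p0 subr_gt0.
(* The numerical margin: the product is 1.024, while [(1 + 1/200)^4 < 1.021]. *)
apply: (@le_trans _ _ (64 / 25 * (12 / 5) / 6 * 1)); first by lra.
apply: (@le_trans _ _ (expR 1 * (12 / 5) / 6 * (2 * B p * l * (1 + z)))).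
  apply: ler_pM => //; lra.
rewrite (_ : expR 1 * _ / 6 * _ = l / 6 * (2 * B p * expR 1) * (12 / 5 * (1 + z))); last by field.
by rewrite ler_pM2l// !mulr_gt0 ?expR_gt0 ?invr_gt0.
Qed.

End RealInequalities.

(** * Noise stability in Fourier terms, and its bound at the base rate *)

Section StabilityBound.
Variables (R : realType) (n : nat) (p : R).
Hypotheses (p_gt0 : 0 < p) (p_lt1 : p < 1).
Implicit Types (S : {set 'I_n}) (c d : {set 'I_n} -> R).
Local Notation u := (hyper_rate p).

Let mu_ge0 (x : cube n) : 0 <= mu p x. Proof. by rewrite ltW// mu_gt0. Qed.

(** With [X = E[H G]] and [K = E[|H| G^2]], Cauchy-Schwarz gives [X^2 <= N K], and again with
    hypercontractivity [K^2 <= |H|_2^2 X^2]. Combining the two and cancelling [X^2] gives the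
    claim. *)
Lemma noise_form_L1_L2 d :
  (\sum_(S : {set 'I_n}) u ^+ #|S| * d S ^+ 2) ^+ 2 <=
  Expect (mu p) (fun x => `|fourier p d x|) ^+ 2 * \sum_(S : {set 'I_n}) d S ^+ 2.
Proof.
set X := \sum_(S : {set 'I_n}) u ^+ #|S| * d S ^+ 2.
pose H := fourier p d; pose G := fourier p (fun S : {set 'I_n} => u ^+ #|S| * d S).
set N := Expect (mu p) (fun x => `|fourier p d x|).
have u0 := ltW (hyper_rate_gt0 p_gt0 p_lt1).
have X0 : 0 <= X by apply: sumr_ge0 => S _; rewrite mulr_ge0 ?sqr_ge0 ?exprn_ge0.
have N0 : 0 <= N by apply: sumr_ge0 => x _; rewrite mulr_ge0.
have HH : Expect (mu p) (fun x => `|H x| ^+ 2) = \sum_(S : {set 'I_n}) d S ^+ 2.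
  transitivity (Expect (mu p) (fun x => H x * H x)).
    by apply: eq_bigr => x _; rewrite -normrX ger0_norm ?sqr_ge0.
  by rewrite parseval//; apply: eq_bigr.
have XE : X = Expect (mu p) (fun x => H x * G x).
  by rewrite parseval//; apply: eq_bigr => S _; ring.
pose K := Expect (mu p) (fun x => `|H x| * G x ^+ 2).
have K0 : 0 <= K by apply: sumr_ge0 => x _; rewrite mulr_ge0// mulr_ge0 ?sqr_ge0.
have XNK : X ^+ 2 <= N * K.
  apply: (@le_trans _ _ (Expect (mu p)
      (fun x => Num.sqrt `|H x| * (Num.sqrt `|H x| * `|G x|)) ^+ 2)).
    rewrite ler_sqr ?nnegrE//; last first.
      by apply: sumr_ge0 => x _; rewrite mulr_ge0// !mulr_ge0 ?sqrtr_ge0.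
    rewrite XE; apply: Expect_le => // x.
    by rewrite mulrA -expr2 sqr_sqrtr// -normrM ler_norm.
  apply: le_trans (Cauchy_Schwarz_sum _ _ mu_ge0) _.
  rewrite le_eqVlt; apply/orP; left; apply/eqP; congr (_ * _).
    by apply: eq_bigr => x _; rewrite sqr_sqrtr.
  by apply: eq_bigr => x _; rewrite exprMn sqr_sqrtr// -[`|G x| ^+ 2]normrX [`|G x ^+ 2|]ger0_norm ?sqr_ge0.
have KX : K ^+ 2 <= (\sum_(S : {set 'I_n}) d S ^+ 2) * X ^+ 2.
  apply: le_trans (Cauchy_Schwarz_sum _ _ mu_ge0) _; rewrite HH ler_wpM2l//.
    by apply: sumr_ge0 => S _; exact: sqr_ge0.
  apply: le_trans (hypercontractivity p_gt0 p_lt1 d).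
  by rewrite le_eqVlt; apply/orP; left; apply/eqP/eq_bigr => x _; rewrite -exprM.
have [X00|XN0] := eqVneq X 0.
  by rewrite X00 expr0n mulr_ge0 ?sqr_ge0// sumr_ge0// => S _; exact: sqr_ge0.
have X2 : 0 < X ^+ 2 by rewrite exprn_gt0// lt_def XN0.
rewrite -(ler_pM2r X2) -[leRHS]mulrA.
apply: (@le_trans _ _ (N ^+ 2 * K ^+ 2)); last by rewrite ler_wpM2l ?sqr_ge0.
by rewrite -expr2 -exprMn ler_sqr ?nnegrE ?mulr_ge0// ltW.
Qed.

Lemma Bernoulli (x : R) k : 0 <= x -> 1 + k%:R * x <= (1 + x) ^+ k.
Proof.
move=> x0; elim: k => [|k IH]; first by rewrite expr0 mul0r addr0.
rewrite exprS; apply: (@le_trans _ _ ((1 + x) * (1 + k%:R * x))); last first.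
  by rewrite ler_wpM2l//; lra.
have : 0 <= k%:R * x * x by rewrite !mulr_ge0.
by rewrite -natr1; lra.
Qed.

Variable f : cube n -> bool.
Local Notation c := (coef p (fun x => (f x)%:R)).

Lemma coef_sqr_sum_le1 : \sum_(S : {set 'I_n}) c S ^+ 2 <= 1.
Proof.
have -> : \sum_(S : {set 'I_n}) c S ^+ 2 = Expect (mu p) (fun x => (f x)%:R * (f x)%:R).
  transitivity (Expect (mu p) (fun x => fourier p c x * fourier p c x)).
    by rewrite parseval.
  by apply: eq_bigr => x _; rewrite fourier_inversion.
rewrite -[leRHS](mu_sum1 n p); apply: ler_sum => x _.
by case: (f x); rewrite /= !(mulr1, mulr0).
Qed.

(** Both marginals of the noise pair are [mu p], so both means equal [c set0] and centring removes
    exactly the empty set. *)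
Lemma noise_stabilityE eps :
  noise_stability p eps f = \sum_(S : {set 'I_n} | S != set0) (1 - eps) ^+ #|S| * c S ^+ 2.
Proof.
set rho := 1 - eps; pose F x : R := (f x)%:R.
have pairE (X : cube n -> cube n -> R) :
    Expect (noise_pair p eps) (fun xy => X xy.1 xy.2) =
    \sum_x \sum_y mu p x * kernel p rho x y * X x y.
  rewrite pair_big/=; apply: eq_bigr => -[x y] _ /=.
  by rewrite /noise_pair/= noiseE.
have c0E : c set0 = Expect (mu p) F.
  by apply: eq_bigr => x _; rewrite /chi big_set0 mulr1.
have E1 : Expect (noise_pair p eps) (fun xy => (f xy.1)%:R) = c set0.
  rewrite c0E (pairE (fun x y => F x)); apply: eq_bigr => x _.
  by rewrite -mulr_suml -mulr_sumr kernel_sum1 mulr1.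
have E2 : Expect (noise_pair p eps) (fun xy => (f xy.2)%:R) = c set0.
  rewrite c0E (pairE (fun x y => F y)) exchange_big; apply: eq_bigr => y _ /=.
  under eq_bigr do rewrite kernel_sym//.
  by rewrite -mulr_suml -mulr_sumr kernel_sum1 mulr1.
pose d (S : {set 'I_n}) := (S != set0)%:R * c S.
have dE x : F x - c set0 = fourier p d x.
  rewrite -[F x](fourier_inversion p_gt0 p_lt1) /fourier (bigD1 set0)//=.
  rewrite [in RHS](bigD1 set0)//= /d eqxx !mul0r add0r /chi big_set0 mulr1.
  rewrite addrAC subrr add0r; apply: eq_bigr => S SN0; by rewrite SN0 mul1r.
rewrite /noise_stability /Cov E1 E2.
rewrite (pairE (fun x y => (F x - c set0) * (F y - c set0))).
transitivity (Expect (mu p) (fun x => fourier p d x *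
    fourier p (fun S : {set 'I_n} => rho ^+ #|S| * d S) x)).
  apply: eq_bigr => x _.
  have -> : fourier p (fun S : {set 'I_n} => rho ^+ #|S| * d S) x = \sum_y kernel p rho x y * fourier p d y.
    by rewrite kernel_fourier//; apply: eq_bigr => S _; rewrite coef_fourier.
  by rewrite !mulr_sumr; apply: eq_bigr => y _; rewrite !dE; ring.
rewrite parseval// [RHS]big_mkcond/=; apply: eq_bigr => S _; rewrite /d.
by case: (S == set0) => /=; ring.
Qed.

Lemma sum_set_card (F : {set 'I_n} -> R) :
  \sum_(i < n) \sum_(S : {set 'I_n}) (i \in S)%:R * F S = \sum_(S : {set 'I_n}) #|S|%:R * F S.
Proof.
rewrite exchange_big; apply: eq_bigr => S _ /=; rewrite -mulr_suml; congr (_ * _).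
by rewrite -natr_sum -sum1_card [X in _ = X%:R]big_mkcond.
Qed.

(* [u w ^+ 2] with [w = (1 + delta)^-1]; the bound [100 = 1 / (2 delta)] below comes
   from [k w ^+ (2 k) <= 1 / (2 delta)]. *)
Definition base_rate : R := u / (1 + 1 / 200) ^+ 2.

Lemma base_rate_gt0 : 0 < base_rate.
Proof. by rewrite divr_gt0 ?hyper_rate_gt0// exprn_gt0//; lra. Qed.

Lemma base_stability_le :
  (\sum_(S : {set 'I_n} | S != set0) base_rate ^+ #|S| * c S ^+ 2) ^+ 2 <= 100 * W p f.
Proof.
set Y := \sum_(S : {set 'I_n} | _) _.
pose w : R := (1 + 1 / 200)^-1.
have w01 : 0 <= w <= 1 by rewrite invr_ge0 invf_le1; lra.
have w0 : 0 <= w by case/andP: w01.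
have b0 := ltW base_rate_gt0.
have bE : base_rate = u * w ^+ 2 by rewrite exprVn.
pose g (i : 'I_n) (S : {set 'I_n}) := (i \in S)%:R * c S.
pose h i (S : {set 'I_n}) := w ^+ #|S| * g i S.
pose N i := Expect (mu p) (fun x => `|fourier p (h i) x|).
pose D i := \sum_(S : {set 'I_n}) h i S ^+ 2.
pose X i := \sum_(S : {set 'I_n}) u ^+ #|S| * h i S ^+ 2.
have N0 i : 0 <= N i by apply: sumr_ge0 => x _; rewrite mulr_ge0.
have D0 i : 0 <= D i by apply: sumr_ge0 => S _; exact: sqr_ge0.
have Y0 : 0 <= Y by apply: sumr_ge0 => S _; rewrite mulr_ge0 ?sqr_ge0 ?exprn_ge0.
(* The sum over [i] counts each [S] with multiplicity [#|S|], which is at least 1 for nonempty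
   [S]. *)
have YX : Y <= \sum_i X i.
  have -> : \sum_i X i = \sum_(S : {set 'I_n}) #|S|%:R * (base_rate ^+ #|S| * c S ^+ 2).
    rewrite -sum_set_card; apply: eq_bigr => i _; apply: eq_bigr => S _.
    rewrite /h /g bE !exprMn; case: (i \in S) => /=; ring.
  rewrite /Y big_mkcond/=; apply: ler_sum => S _.
  case: ifP => SN0; last by rewrite mulr_ge0// mulr_ge0 ?sqr_ge0 ?exprn_ge0.
  apply: ler_peMl; last by rewrite ler1n card_gt0 SN0.
  by rewrite mulr_ge0 ?sqr_ge0 ?exprn_ge0.
have XN i : X i <= N i * Num.sqrt (D i).
  rewrite -ler_sqr ?nnegrE ?mulr_ge0 ?sqrtr_ge0//; last first.
    apply: sumr_ge0 => S _; rewrite mulr_ge0 ?sqr_ge0 ?exprn_ge0// ltW//.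
    exact: hyper_rate_gt0.
  by rewrite exprMn sqr_sqrtr//; exact: noise_form_L1_L2.
(* Cauchy-Schwarz over coordinates separates the [L^1] norms, which yield [W], from the damped total
   influence. *)
have YCS : Y ^+ 2 <= (\sum_i N i ^+ 2) * (\sum_i D i).
  apply: (@le_trans _ _ ((\sum_i N i * Num.sqrt (D i)) ^+ 2)).
    rewrite ler_sqr ?nnegrE//; last by apply: sumr_ge0 => i _; rewrite mulr_ge0 ?sqrtr_ge0.
    by apply: le_trans YX _; apply: ler_sum.
  have := @Cauchy_Schwarz_sum R 'I_n (fun=> 1) N (fun i => Num.sqrt (D i)) (fun=> ler01).
  rewrite /Expect; under eq_bigr do rewrite mul1r.
  under [X in _ <= X * _ -> _]eq_bigr do rewrite mul1r.
  by under [X in _ <= _ * X -> _]eq_bigr do rewrite mul1r sqr_sqrtr//.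
have NW : \sum_i N i ^+ 2 <= W p f.
  rewrite /W mulr_sumr; apply: ler_sum => i _.
  have I0 : 0 <= influence p f i by apply: sumr_ge0.
  have q0 : 0 < 1 - p by rewrite subr_gt0.
  have NI : N i <= 2 * p * (1 - p) * influence p f i.
    rewrite -norm_coordinate_part//; exact: noise_operator_L1_contraction.
  (* The square is [4 p (1 - p)] times the [i]-th term of [W], and
     [1 - 4 p (1 - p) = (1 - 2 p)^2]. *)
  apply: (@le_trans _ _ ((2 * p * (1 - p) * influence p f i) ^+ 2)).
    by rewrite ler_sqr ?nnegrE// !mulr_ge0// ltW.
  rewrite (_ : (2 * _ * _ * _) ^+ 2 =
    4 * (p * (1 - p)) * (p * (1 - p) * influence p f i ^+ 2)); last by ring.
  rewrite ler_piMl//; first by rewrite mulr_ge0 ?sqr_ge0// mulr_ge0// ltW.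
  have := sqr_ge0 (1 - 2 * p); lra.
have D100 : \sum_i D i <= 100.
  have -> : \sum_i D i = \sum_(S : {set 'I_n}) #|S|%:R * (w ^+ (2 * #|S|) * c S ^+ 2).
    rewrite -sum_set_card; apply: eq_bigr => i _; apply: eq_bigr => S _.
    rewrite /h /g !exprMn -exprM mulnC; case: (i \in S) => /=; ring.
  apply: (@le_trans _ _ (\sum_(S : {set 'I_n}) 100 * c S ^+ 2)); last first.
    by rewrite -mulr_sumr; have := coef_sqr_sum_le1; lra.
  apply: ler_sum => S _; rewrite mulrA ler_wpM2r ?sqr_ge0// exprVn ler_pdivrMr; last first.
    by rewrite exprn_gt0//; lra.
  have := @Bernoulli (1 / 200) (2 * #|S|); rewrite natrM; lra.
apply: le_trans YCS _; rewrite mulrC; apply: ler_pM => //; apply: sumr_ge0 => i _ //.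
exact: sqr_ge0.
Qed.

End StabilityBound.

(** * Jensen's inequality for concave powers *)

Section PowerMean.
Variable R : realType.

Lemma powR_le_tangent (y b : R) : 0 <= y -> 0 < b -> b <= 1 -> y `^ b <= 1 - b + b * y.
Proof.
move=> y0 b0 b1; have [->|yN0] := eqVneq y 0.
  by rewrite powR0 ?gt_eqF// mulr0; lra.
have yp : 0 < y by rewrite lt_def yN0.
rewrite -{2}(lnK (_ : y \in Num.pos)) ?posrE// /powR (negbTE yN0); set s := ln y.
set E := expR (b * s); have E0 : 0 <= E := expR_ge0 _.
(* The combination of [h1] and [h2] with weights [b] and [1 - b] cancels [s] and leaves [E] on the
   left. *)
have h1 : E * (1 + (1 - b) * s) <= expR s.
  rewrite (_ : expR s = E * expR ((1 - b) * s)); last by rewrite -expRD; congr expR; ring.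
  by rewrite ler_wpM2l// expR_ge1Dx.
have h2 : E * (1 - b * s) <= 1.
  rewrite -[leRHS]expR0 (_ : expR 0 = E * expR (- (b * s))); last by rewrite -expRD addrN.
  by rewrite ler_wpM2l// expR_ge1Dx.
have h3 : b * (E * (1 + (1 - b) * s)) <= b * expR s by rewrite ler_wpM2l// ltW.
have h4 : (1 - b) * (E * (1 - b * s)) <= (1 - b) * 1 by rewrite ler_wpM2l// subr_ge0.
by have := lerD h3 h4; lra.
Qed.

(** Each [x i] is compared with the tangent of the power at the mean [Y]. Total weight below 1
    suffices because the constant term [1 - b] of the tangent is nonnegative. *)
Lemma powR_mean_le (I : finType) (P : pred I) (v x : I -> R) (b : R) :
  (forall i, 0 <= v i) -> (forall i, 0 <= x i) -> \sum_(i | P i) v i <= 1 ->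
  0 < b -> b <= 1 ->
  \sum_(i | P i) x i `^ b * v i <= (\sum_(i | P i) x i * v i) `^ b.
Proof.
move=> v0 x0 v1 b0 b1; set Y := \sum_(i | P i) x i * v i.
have xv0 i : 0 <= x i * v i by rewrite mulr_ge0.
have Y0 : 0 <= Y by apply: sumr_ge0.
have [YE|YN0] := eqVneq Y 0.
  rewrite YE powR0 ?gt_eqF// big1// => i Pi.
  have /eqP := psumr_eq0P (fun i _ => xv0 i) YE Pi.
  by rewrite mulf_eq0 => /orP[] /eqP ->; rewrite ?mulr0// powR0 ?gt_eqF ?mul0r.
have Yp : 0 < Y by rewrite lt_def YN0.
apply: (@le_trans _ _ (\sum_(i | P i) Y `^ b * (1 - b + b * (x i / Y)) * v i)).
  apply: ler_sum => i _; rewrite ler_wpM2r//.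
  rewrite -{1}(mulfVK YN0 (x i)) powRM ?divr_ge0// mulrC ler_wpM2l ?powR_ge0//.
  by rewrite powR_le_tangent ?divr_ge0.
under eq_bigr do rewrite -mulrA; rewrite -mulr_sumr ler_piMr ?powR_ge0//.
have -> : \sum_(i | P i) (1 - b + b * (x i / Y)) * v i =
    (1 - b) * (\sum_(i | P i) v i) + b * (Y / Y).
  by rewrite mulr_suml !mulr_sumr -big_split/=; apply: eq_bigr => i _; ring.
rewrite divff//.
have : (1 - b) * (\sum_(i | P i) v i) <= (1 - b) * 1 by rewrite ler_wpM2l// subr_ge0.
lra.
Qed.

End PowerMean.

(** * Transfer from the base rate to the rate [1 - eps] *)

Theorem theorem1p7 (R : realType) (n : nat) (p : R) (f : cube n -> bool)
    (hp0 : 0 < p) (hp1 : p < 1) (eps : R) (heps0 : 0 < eps) (heps1 : eps <= 1) :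
  noise_stability p eps f <=
    (6 * expR 1 + 1) * powR (W p f) (alpha p eps * eps).
Proof.
have [L1 Lw] := stability_L_bounds hp0 hp1; set L := stability_L p in L1 Lw.
have Lp : 0 < L by lra.
have lnL0 : 0 <= ln L by rewrite ln_ge0//; lra.
pose D := eps + L + 3 * ln L; have D0 : 0 < D by rewrite /D; lra.
have aE : alpha p eps * eps = eps / D by rewrite /alpha mul1r mulrC.
rewrite aE; set a := eps / D.
have a0 : 0 < a by rewrite divr_gt0.
(* Since [eps <= 1 <= L], [D >= 2 eps]; this makes [2 * a] an admissible exponent for Jensen and
   later bounds [100 ^ a]. *)
have a2 : a <= 1 / 2 by rewrite ler_pdivrMr// /D; lra.
pose r := base_rate p; have r0 : 0 < r := base_rate_gt0 hp0 hp1.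
have expL : expR (- (L + 3 * ln L)) <= r ^+ 2.
  have B0 : 0 < 2 * B p * expR 1.
    by have [z _ [B0 _ _]] := B_bounds hp0 hp1; rewrite !mulr_gt0 ?expR_gt0.
  have eL : expR (L + 3 * ln L) = 2 * B p * expR 1 * L ^+ 3.
    by rewrite expRD expRM_natl lnK ?posrE// lnK ?posrE.
  rewrite expRN eL /r /base_rate expr_div_n sqr_hyper_rate// -exprM.
  rewrite ler_pdivlMr ?exprn_gt0//; last by lra.
  rewrite mulrC ler_pdivrMr; last by rewrite mulr_gt0 ?exprn_gt0.
  by rewrite [leRHS]mulrA.
(* The chain is [1 - eps <= e^(- eps) = e^(- D a) <= e^(- (L + 3 ln L) a) <= r^(2 a)]. *)
have epsr : 1 - eps <= r `^ (2 * a).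
  apply: (@le_trans _ _ (expR (- eps))); first exact: expR_ge1Dx.
  rewrite powRrM (_ : r `^ 2 = r ^+ 2); last by rewrite powR_mulrn// ltW.
  apply: (@le_trans _ _ (expR (- (L + 3 * ln L)) `^ a)); last first.
    by rewrite ge0_ler_powR ?nnegrE ?expR_ge0 ?sqr_ge0// ltW.
  rewrite -expRM ler_expR mulNr lerN2 [leRHS](_ : eps = D * a); last first.
    by rewrite /a mulrC divfK// gt_eqF.
  rewrite ler_wpM2r ?(ltW a0)// /D; lra.
pose c := coef p (fun x : cube n => (f x)%:R).
pose Y := \sum_(S : {set 'I_n} | S != set0) r ^+ #|S| * c S ^+ 2.
have Y0 : 0 <= Y.
  by apply: sumr_ge0 => S _; rewrite mulr_ge0 ?sqr_ge0 ?exprn_ge0// ltW.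
have W0 : 0 <= W p f.
  rewrite /W mulr_ge0 ?sumr_ge0//; first by rewrite ltW// mulr_gt0// subr_gt0.
  by move=> i _; exact: sqr_ge0.
have SY : noise_stability p eps f <= Y `^ (2 * a).
  rewrite noise_stabilityE//.
  apply: (@le_trans _ _ (\sum_(S : {set 'I_n} | S != set0) (r ^+ #|S|) `^ (2 * a) * c S ^+ 2)).
    apply: ler_sum => S _; rewrite ler_wpM2r ?sqr_ge0//.
    rewrite -(powR_mulrn _ (ltW r0)) powRAC powR_mulrn ?powR_ge0//.
    by rewrite lerXn2r ?nnegrE ?powR_ge0 ?subr_ge0.
  apply: powR_mean_le; [by move=> S; exact: sqr_ge0
    |by move=> S; rewrite exprn_ge0// ltW| |lra|lra].
  apply: le_trans (coef_sqr_sum_le1 hp0 hp1 f).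
  rewrite [leLHS]big_mkcond/=; apply: ler_sum => S _.
  by case: ifP => _ //; exact: sqr_ge0.
apply: le_trans SY _; rewrite powRrM (powR_mulrn 2)//.
apply: (@le_trans _ _ ((100 * W p f) `^ a)).
  apply: ge0_ler_powR; rewrite ?nnegrE ?sqr_ge0 ?(ltW a0)//; first exact: mulr_ge0.
  exact: base_stability_le.
rewrite powRM// ler_wpM2r ?powR_ge0//.
(* As [a <= 1/2], the constant is at most [sqrt 100 = 10], below [6 e + 1]. *)
apply: (@le_trans _ _ (100 `^ (2^-1))); first by rewrite ler_powR//; lra.
rewrite powR12_sqrt// (_ : 100 = 10 ^+ 2); last by ring.
by rewrite sqrtr_sqr ger0_norm//; have [? _] := expR1_bounds R; lra.
Qed.
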